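(* Let $n\ge 1$ be an odd integer and $q=3^n$. If $n\geq 3$, then $t^-(q):=q-\sqrt{3q}+1$ is divisible by a primitive prime divisor $\mathrm{ppd}(3,6n)$ (of $q^2-q+1$). In all cases, $t^+(q):=q+\sqrt{3q}+1$ is divisible by a primitive prime divisor $\mathrm{ppd}(3,6n)$ (of $q^2-q+1$).
   Context: For integers $a,m\geq 2$, a primitive prime divisor $\mathrm{ppd}(a,m)$ is a prime divisor of $a^m-1$ that does not divide $\prod_{j=1}^{m-1}(a^j-1)$. Note $q^2-q+1=t^-(q)t^+(q)$, and $t^\pm(q)$ are integers since $n$ is odd. *)

(* Defs.v *)
From mathcomp Require Import all_boot all_order all_algebra.

Set Implicit Arguments.
Unset Strict Implicit.
Unset Printing Implicit Defensive.

Import Order.TTheory GRing.Theory Num.Theory.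

(* For a, m >= 2.  As a >= 1, the truncated subtractions of nat are genuine.  *)
Definition is_ppd (a m p : nat) : Prop :=
  [/\ prime p, p %| a ^ m - 1 & ~~ (p %| \prod_(1 <= j < m) (a ^ j - 1))].

Local Open Scope ring_scope.

Definition t_minus (R : rcfType) (q : R) : R := q - Num.sqrt (3 * q) + 1.
Definition t_plus (R : rcfType) (q : R) : R := q + Num.sqrt (3 * q) + 1.

(* t_minus and t_plus are a priori only real numbers: being divisible by p
   includes being an integer.                                                 *)
Definition nat_divides_real (R : rcfType) (p : nat) (x : R) : Prop :=
  exists t : int, x = t%:~R /\ (p%:Z %| t)%Z.

(* Main.v *)
Require Import Defs.
From mathcomp Require Import all_boot all_order all_algebra.
From mathcomp Require Import ring zify.
Local Open Scope ring_scope.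
Set Implicit Arguments.
Unset Strict Implicit.
Unset Printing Implicit Defensive.
Import GRing.Theory Num.Theory.

(**
Write n = 2k + 1.  As sqrt(3 * 3^n) = 3^(k+1), the two numbers are the integers
3^n +- 3^(k+1) + 1, the Aurifeuillean factors of Phi_6(3^n), where
Phi_6(x) = x^2 - x + 1.  They are odd, prime to 3 and differ by 2 * 3^(k+1), so
they are coprime.

Let p be a prime divisor of Phi_6(3^n).  Modulo p the number 3^n has order 6,
hence the order of 3 divides 6n, and the primes 2 and 3 cannot divide its
cofactor in 6n.  So either p is a primitive prime divisor of 3^(6n) - 1, or p
divides Phi_6(3^(n/r)) for some prime r >= 5 dividing n (ppd_of_new_prime).  The
task is thus to show that not all of each factor is made of such old primes.

The old primes are removed one r at a time.  For a list L of primes r >= 5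
dividing n, let G(n, L) be the part of the chosen factor coming from the primes
that divide no Phi_6(3^(n/r)) with r in L.  For r outside L, the part of G(n, L)
that is lost in G(n, r :: L) comes from the primes dividing Phi_6(3^(n/r)).  It
is G(n/r, L), for the appropriate choice of sign at n/r, up to a factor r:
- one factor at n/r divides the chosen factor at n (aurif_dvd), the sign being
  governed by the residue of r modulo 12;
- lifting the exponent shows that at most one further factor r appears
  (logn_aurif_exp).
So G(n, r :: L) * G(n/r, L) equals G(n, L) or G(n, L) / r, and it only remains to
follow the sizes.  Each factor at n lies between 3^n / 3 and 3 * 3^n; by
induction on L, G(n, L) is 3^(n * prod (1 - 1/r)) up to a multiplicative error
slack L, with slack nil = 3 and slack (r :: L) = r * (slack L)^2
(new_part_bounds).  So one step doubles log (slack L) and adds log r, whereas it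
multiplies the product of the r - 1, a divisor of the exponent, by r - 1 >= 4.
This keeps the error below the main term (slack_cons_lt), and G > 1 as soon as
n >= 3.  For n = 1 the larger factor is 7.
*)

(** * The polynomial x^2 - x + 1 and its Aurifeuillean factors in a ring *)

Lemma coprime6P (r : nat) : coprime r 6 -> (r %% 6 = 1 \/ r %% 6 = 5)%N.
Proof.
rewrite -coprime_modl; have : (r %% 6 < 6)%N by rewrite ltn_mod.
by case: (r %% 6)%N => [|[|[|[|[|[|]]]]]] //; auto.
Qed.

Lemma coprime12P (r : nat) :
  coprime r 6 -> [\/ r %% 12 = 1, r %% 12 = 5, r %% 12 = 7 | r %% 12 = 11]%N.
Proof.
move=> /coprime6P h.
have : [|| r %% 12 == 1, r %% 12 == 5, r %% 12 == 7 | r %% 12 == 11]%N by lia.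
by case/or4P => /eqP ->; [constructor 1|constructor 2|constructor 3|constructor 4].
Qed.

Lemma prime_coprime6 (r : nat) : prime r -> (4 < r)%N -> coprime r 6.
Proof.
move=> pr r4; rewrite prime_coprime //; apply/negP => r6.
have : (r <= 6)%N by exact: dvdn_leq r6.
by case: r pr r4 r6 => [|[|[|[|[|[|[|]]]]]]].
Qed.

Section Roots.
Variable A : comNzRingType.
Implicit Types x N : A.

Lemma phi6_cube x : x ^+ 2 - x + 1 = 0 -> x ^+ 3 = -1.
Proof.
move=> h; apply/eqP; rewrite -subr_eq0; apply/eqP.
have -> : x ^+ 3 - -1 = (x + 1) * (x ^+ 2 - x + 1) by ring.
by rewrite h mulr0.
Qed.

Lemma phi6_expr6 x : x ^+ 2 - x + 1 = 0 -> x ^+ 6 = 1.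
Proof. by move=> /phi6_cube h; rewrite (exprM x 3 2) h sqrrN expr1n. Qed.

(** An exponent prime to 6 acts on a 6th root of unity as 1 or -1, and the
    polynomial is reciprocal. *)
Lemma phi6_expr x r : coprime r 6 -> x ^+ 6 = 1 ->
  (x ^+ r) ^+ 2 - x ^+ r + 1 = 0 <-> x ^+ 2 - x + 1 = 0.
Proof.
move=> /coprime6P r6 x6; rewrite -(expr_mod r x6).
case: r6 => ->; first by rewrite expr1.
have -> : (x ^+ 5) ^+ 2 - x ^+ 5 + 1 = x ^+ 6 * x ^+ 4 - x ^+ 5 + 1 by ring.
rewrite x6 mul1r; split=> h.
  have -> : x ^+ 2 - x + 1 = x ^+ 2 * (x ^+ 4 - x ^+ 5 + 1) - (x ^+ 6 - 1) * (1 - x).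
    by ring.
  by rewrite h x6 subrr mulr0 mul0r subr0.
have -> : x ^+ 4 - x ^+ 5 + 1 = x ^+ 4 * (x ^+ 2 - x + 1) - (x ^+ 6 - 1) by ring.
by rewrite h x6 subrr mulr0 subr0.
Qed.

Lemma expr_gcdn x a b : (0 < a)%N -> x ^+ a = 1 -> x ^+ b = 1 -> x ^+ gcdn a b = 1.
Proof.
move=> a0 xa xb; case: (egcdnP b a0) => u v uv _.
have : x ^+ (u * a) = 1 by rewrite mulnC exprM xa expr1n.
by rewrite uv exprD mulnC exprM xb expr1n mul1r.
Qed.

(** The quadratic character modulo 12, the one of the field of sqrt 3: it tells
    which r exchange the two signs when n is multiplied by r. *)
Definition flips (r : nat) : bool := (r %% 12 == 5)%N || (r %% 12 == 7)%N.

(** With x = z^2 and N = sqrt 3 * z, the left-hand side x + N + 1 has the root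
    z = a primitive 12th root of unity, and z^r is a root of the same quadratic or
    of its companion with -sqrt 3 according to r modulo 12.  Stated with x and N
    the identity needs no square root and holds in any commutative ring; it is
    checked in the basis (1, N) over the integers. *)
Lemma aurifeuille_expr x N r : coprime r 6 -> N ^+ 2 = 3%:R * x -> x + N + 1 = 0 ->
  x ^+ r + (-1) ^+ flips r * N * x ^+ r./2 + 1 = 0.
Proof.
move=> r6 N2 xN.
have xE : x = - N - 1 by rewrite -[LHS]subr0 -xN; ring.
have NN : N ^+ 2 = - (3%:R * N) - 3%:R by rewrite N2 xE; ring.
have x2 : x ^+ 2 = - N - 2%:R.
  have -> : x ^+ 2 = N ^+ 2 + 2%:R * N + 1 by rewrite xE; ring.
  by rewrite NN; ring.
have Nx2 : N * x ^+ 2 = N + 3%:R.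
  have -> : N * x ^+ 2 = - N ^+ 2 - 2%:R * N by rewrite x2; ring.
  by rewrite NN; ring.
have x3 : x ^+ 3 = -1 by apply: phi6_cube; rewrite x2 xE; ring.
have x5 : x ^+ 5 = N + 2%:R by rewrite (exprD x 3 2) x3 x2; ring.
have x6 : x ^+ 6 = 1 by rewrite (exprD x 3 3) x3; ring.
have x7 : x ^+ 7 = x by rewrite (exprD x 6 1) x6; ring.
have x11 : x ^+ 11 = N + 2%:R by rewrite (exprD x 6 5) x6 x5; ring.
have x12 : x ^+ 12 = 1 by rewrite (exprD x 6 6) x6; ring.
have -> : x ^+ r = x ^+ (r %% 12)%N by rewrite expr_mod.
have -> : x ^+ r./2 = x ^+ (r %% 12)%N./2.
  have -> : (r./2 = 6 * (r %/ 12) + (r %% 12)./2)%N by lia.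
  by rewrite exprD exprM x6 expr1n mul1r.
rewrite /flips; case: (coprime12P r6) => -> /=.
- by rewrite -xN; ring.
- by rewrite x5 -mulrA Nx2; ring.
- by rewrite x7 x3 -xN; ring.
- have -> : x ^+ 11 + 1 * N * x ^+ 5 + 1 = N ^+ 2 + 3%:R * N + 3%:R.
    by rewrite x11 x5; ring.
  by rewrite NN; ring.
Qed.

End Roots.

(** * Prime divisors of x^2 - x + 1 *)

Lemma dvdn_Zp (d k : nat) : (1 < d)%N -> (d %| k)%N = (k%:R == 0 :> 'Z_d).
Proof.
by move=> d1; rewrite Zp_nat -val_eqE /= Zp_cast // mod0n.
Qed.

Local Open Scope nat_scope.

Definition phi6 (x : nat) : nat := x ^ 2 - x + 1.

Lemma phi6_gt0 x : 0 < phi6 x. Proof. by rewrite /phi6 addn1. Qed.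

Lemma phi6_natr (A : comNzRingType) (x : nat) :
  ((phi6 x)%:R = x%:R ^+ 2 - x%:R + 1 :> A)%R.
Proof.
rewrite /phi6 natrD natrB ?natrX //.
by case: x => // x; rewrite -[leqLHS]expn1 leq_pexp2l.
Qed.

Lemma dvdn_phi6_Zp d x : 1 < d ->
  (d %| phi6 x) <-> (x%:R ^+ 2 - x%:R + 1 = 0 :> 'Z_d)%R.
Proof. by move=> d1; rewrite dvdn_Zp // phi6_natr; split=> /eqP. Qed.

Lemma dvdn_subn1_Zp d x : 1 < d -> 0 < x -> (d %| x - 1) <-> (x%:R = 1 :> 'Z_d)%R.
Proof.
by move=> d1 x0; rewrite dvdn_Zp // natrB // subr_eq0; split=> /eqP.
Qed.

Lemma phi6_dvd_expr6 x : 0 < x -> phi6 x %| x ^ 6 - 1.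
Proof.
move=> x0; have [d1|] := ltnP 1 (phi6 x); last first.
  by have := phi6_gt0 x; case: (phi6 x) => [|[]] //; rewrite dvd1n.
apply/dvdn_subn1_Zp; rewrite ?expn_gt0 ?x0 // natrX.
by apply/phi6_expr6/dvdn_phi6_Zp.
Qed.

Lemma dvdn_phi6_exp d x r : 0 < x -> coprime r 6 -> d %| x ^ 6 - 1 ->
  (d %| phi6 (x ^ r)) = (d %| phi6 x).
Proof.
move=> x0 r6; have [d1|] := ltnP 1 d; last first.
  case: d => [|[|//]]; rewrite ?dvd1n // !dvd0n => _ _.
  by rewrite !eqn0Ngt !phi6_gt0.
move=> /dvdn_subn1_Zp; rewrite expn_gt0 x0 natrX => /(_ d1 isT) x6.
by apply/idP/idP => /(dvdn_phi6_Zp _ d1) h; apply/(dvdn_phi6_Zp _ d1);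
   move: h; rewrite natrX; apply (phi6_expr r6 x6).
Qed.

Lemma phi6E x : phi6 x = x * x.-1 + 1.
Proof. by case: x => // x; rewrite /phi6 -mulnn mulnS addKn mulnC. Qed.

(** The number x^2 - x + 1 is odd, and it is 1 modulo 3 when 3 divides x.  The
    exclusion of 2 and 3 gives a root of x^2 - x + 1 modulo p order exactly 6. *)
Lemma prime_phi6_pow3 p e : 0 < e -> prime p -> p %| phi6 (3 ^ e) -> 3 < p.
Proof.
case: e => // e _ pp; rewrite phi6E ltnNge; case: p pp => [|[|[|[|]]]] // _ h.
  by move: h; rewrite dvdn2 addn1 /= negbK oddM -subn1 oddB ?expn_gt0 // oddX.
by move: h; rewrite dvdn_addr // expnS -mulnA dvdn_mulr.
Qed.

(** The hypotheses force y^6 = 1 modulo d, as r and s are coprime.  For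
    y = 3^(n/(r s)), a prime already occurring at n/s and at n/r thus occurs at
    n/(r s): this is what makes the removal of r compatible with that of s. *)
Lemma dvdn_phi6_gcd d y r s : 0 < y -> coprime r 6 -> coprime s 6 -> coprime r s ->
  d %| phi6 (y ^ r) -> d %| phi6 (y ^ s) -> d %| phi6 y.
Proof.
move=> y0 r6 s6 rs; have [d1|] := ltnP 1 d; last first.
  case: d => [|[|//]]; rewrite ?dvd1n // !dvd0n => _ .
  by rewrite !eqn0Ngt !phi6_gt0.
move=> hr hs; rewrite -(@dvdn_phi6_exp d y r) //.
apply/dvdn_subn1_Zp; rewrite ?expn_gt0 ?y0 // natrX.
have pow6 t : d %| phi6 (y ^ t) -> (y%:R ^+ (t * 6) = 1 :> 'Z_d)%R.
  by move=> /(dvdn_phi6_Zp _ d1)/phi6_expr6; rewrite natrX exprM.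
have r0 : 0 < r * 6 by rewrite muln_gt0; case: r r6 {rs hr}.
have := expr_gcdn r0 (pow6 _ hr) (pow6 _ hs).
by rewrite -muln_gcdl (eqP rs) mul1n.
Qed.

(** The core of lifting the exponent.  The sum is r modulo p; when r = p it is
    p + b p^2 (p - 1) / 2 modulo p^2 with a = 1 + p b, so p divides it only once,
    p being odd. *)
Lemma logn_geometric_sum p a r : prime p -> odd p -> prime r -> 0 < a -> p %| a - 1 ->
  logn p (\sum_(i < r) a ^ i) <= logn p r.
Proof.
move=> pp op pr a0 pa; rewrite (logn_prime _ pr) leqNgt -pfactor_dvdn //; last first.
  by case: r pr => // r _; rewrite big_ord_recl expn0.
have [b aE] : exists b, a = 1 + p * b.
  by case/dvdnP: pa => b ab; exists b; lia.
have modp2 i : a ^ i = 1 + i * (p * b) %[mod p ^ 2].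
  elim: i => [|i IH]; first by [].
  rewrite expnS -modnMmr IH modnMmr aE -[RHS](modnMDl (i * b ^ 2)).
  by congr (_ %% _); ring.
have [pr_eq|npr] := eqVneq p r; last first.
  rewrite expn1; apply/negP => h.
  have : \sum_(i < r) a ^ i = r %[mod p].
    rewrite -modn_summ (eq_bigr (fun=> 1 %% p)) => [|i _]; last first.
      have := modp2 i => /(congr1 (modn^~ p)); rewrite !modn_dvdm ?dvdn_exp //.
      by move=> ->; rewrite addnC mulnCA mulnC modnMDl.
    by rewrite modn_summ sum1_card card_ord.
  rewrite (eqP h) => /esym/eqP; rewrite -/(dvdn p r) dvdn_prime2 //.
  by rewrite (negPf npr).
apply/negP => h; have : \sum_(i < r) a ^ i = p %[mod p ^ 2].
  rewrite -modn_summ.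
  rewrite (eq_bigr (fun i : 'I_r => (1 + i * (p * b)) %% p ^ 2)) => [|i _]; last first.
    exact: modp2.
  rewrite modn_summ big_split /= sum1_card card_ord -big_distrl /= -pr_eq.
  rewrite -(big_mkord xpredT id) bin2_sum.
  have -> : 'C(p, 2) = p * (p.-1)./2.
    rewrite bin2; case: (p) op => // k; rewrite oddS succnK => ek.
    by rewrite -{2}(even_halfK ek) -doubleMr doubleK.
  have -> : p * p.-1./2 * (p * b) = p.-1./2 * b * p ^ 2 by ring.
  by rewrite addnC modnMDl.
rewrite (eqP h) => /esym/eqP; rewrite -/(dvdn _ p) => /dvdn_leq.
by have := prime_gt1 pp; nia.
Qed.

Lemma cube_subn1 z : z.+1 ^ 3 - 1 = z ^ 3 + 3 * z ^ 2 + 3 * z.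
Proof.
have -> : z.+1 ^ 3 = z ^ 3 + 3 * z ^ 2 + 3 * z + 1 by ring.
by rewrite addnK.
Qed.

Lemma phi6_cofactor x : 0 < x -> x ^ 6 - 1 = phi6 x * ((x + 1) * (x ^ 3 - 1)).
Proof.
case: x => // z _; rewrite cube_subn1 phi6E succnK -[RHS](addnK 1).
by congr (_ - 1); ring.
Qed.

Lemma prime_ndvd_phi6_cofactor p x : 3 < p -> prime p -> 0 < x -> p %| phi6 x ->
  ~~ (p %| (x + 1) * (x ^ 3 - 1)).
Proof.
case: x => // z p3 pp _ px; rewrite Euclid_dvdM //.
apply/negP => /orP[px1|px3].
  have : p %| phi6 z.+1 + 3 * (z.+1 + 1) by rewrite dvdn_add // dvdn_mull.
  have -> : phi6 z.+1 + 3 * (z.+1 + 1) = (z.+1 + 1) ^ 2 + 3.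
    by rewrite phi6E succnK; ring.
  by rewrite dvdn_addr ?dvdn_exp // => /dvdn_leq; lia.
have : p %| phi6 z.+1 * (z.+1 + 1) by rewrite dvdn_mulr.
have -> : phi6 z.+1 * (z.+1 + 1) = z.+1 ^ 3 - 1 + 2.
  by rewrite cube_subn1 phi6E succnK; ring.
by rewrite dvdn_addr // => /dvdn_leq; lia.
Qed.

(** Lifting the exponent from x^6 to x^(6 r), the cofactor of x^2 - x + 1 in
    x^6 - 1 being prime to p. *)
Lemma logn_phi6_exp p x r : 3 < p -> prime p -> prime r -> 0 < x -> p %| phi6 x ->
  logn p (phi6 (x ^ r)) <= logn p (phi6 x) + logn p r.
Proof.
move=> p3 pp pr x0 px.
have op : odd p by case: (even_prime pp) => // p2; rewrite p2 in p3.
have p6 : p %| x ^ 6 - 1 := dvdn_trans px (phi6_dvd_expr6 x0).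
have x6_gt0 : 0 < x ^ 6 by rewrite expn_gt0 x0.
have [->|x1] := eqVneq x 1; first by rewrite exp1n leq_addr.
have x3_gt1 : 1 < x ^ 3 by rewrite -(exp1n 3) ltn_exp2r // ltn_neqAle eq_sym x1.
have cof0 : logn p ((x + 1) * (x ^ 3 - 1)) = 0.
  by apply/logn_coprime; rewrite prime_coprime // prime_ndvd_phi6_cofactor.
have xr_gt0 : 0 < x ^ r by rewrite expn_gt0 x0.
have S0 : 0 < \sum_(i < r) (x ^ 6) ^ i.
  by case: r pr {xr_gt0} => // r _; rewrite big_ord_recl expn0.
have xr6E : (x ^ r) ^ 6 - 1 = (x ^ 6 - 1) * \sum_(i < r) (x ^ 6) ^ i.
  by rewrite -!expnM mulnC expnM !subn1 predn_exp.
have cof_gt0 : 0 < (x + 1) * (x ^ 3 - 1) by rewrite muln_gt0 addn1 subn_gt0.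
have : logn p (phi6 (x ^ r)) <= logn p ((x ^ r) ^ 6 - 1).
  apply: dvdn_leq_log; last exact: phi6_dvd_expr6.
  by rewrite xr6E phi6_cofactor // muln_gt0 S0 andbT muln_gt0 phi6_gt0 cof_gt0.
rewrite xr6E phi6_cofactor // lognM ?[0 < phi6 _ * _]muln_gt0 ?phi6_gt0 //.
rewrite (lognM _ (phi6_gt0 x) cof_gt0).
rewrite cof0 addn0 => /leq_trans; apply.
by rewrite leq_add2l; apply: logn_geometric_sum.
Qed.

(** * The Aurifeuillean factors at powers of 3 *)

(** For odd n, uphalf n = (n + 1) / 2, so 3 ^ uphalf n is sqrt (3 * 3 ^ n). *)
Definition aurif (b : bool) (n : nat) : nat :=
  if b then 3 ^ n + 1 + 3 ^ (uphalf n) else 3 ^ n + 1 - 3 ^ (uphalf n).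

Lemma uphalf_leq_pow3 n : 0 < n -> 3 ^ uphalf n <= 3 ^ n.
Proof. by move=> n0; rewrite leq_pexp2l //; lia. Qed.

Lemma aurif_gt0 b n : 0 < n -> 0 < aurif b n.
Proof. by move=> /uphalf_leq_pow3; rewrite /aurif; case: b; lia. Qed.

Lemma sqr_pow3_uphalf n : odd n -> (3 ^ uphalf n) ^ 2 = 3 * 3 ^ n.
Proof. by move=> on; rewrite -expnM -expnS; congr (3 ^ _); lia. Qed.

Lemma aurif_mul n : odd n -> aurif true n * aurif false n = phi6 (3 ^ n).
Proof.
move=> on; have n0 := odd_gt0 on.
have N2 := sqr_pow3_uphalf on; have Nx := uphalf_leq_pow3 n0; rewrite /aurif.
rewrite mulnC -subn_sqr N2 phi6E -[RHS](addnK (3 * 3 ^ n)); congr (_ - _).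
have : 0 < 3 ^ n by rewrite expn_gt0.
by case: (3 ^ n) => // z _; rewrite succnK; ring.
Qed.

Lemma aurif_dvd_phi6 b n : odd n -> aurif b n %| phi6 (3 ^ n).
Proof.
by move=> on; rewrite -aurif_mul //; case: b; [exact: dvdn_mulr|exact: dvdn_mull].
Qed.

Lemma aurif_coprime p n : 3 < p -> prime p -> odd n ->
  ~~ [&& p %| aurif true n & p %| aurif false n].
Proof.
move=> p3 pp on; apply/negP => /andP[h1 h2].
have := uphalf_leq_pow3 (odd_gt0 on).
have : p %| aurif true n - aurif false n by rewrite dvdn_sub.
rewrite /aurif => h Nx; move: h.
have -> : 3 ^ n + 1 + 3 ^ uphalf n - (3 ^ n + 1 - 3 ^ uphalf n) = 2 * 3 ^ uphalf n by lia.
rewrite Euclid_dvdM // => /orP[/dvdn_leq|]; first by lia.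
by rewrite Euclid_dvdX // => /andP[/dvdn_leq]; lia.
Qed.

Lemma aurif_natr (A : comNzRingType) b n : 0 < n ->
  ((aurif b n)%:R = 3%:R ^+ n + (-1) ^+ (~~ b) * 3%:R ^+ uphalf n + 1 :> A)%R.
Proof.
move=> n0; rewrite /aurif; case: b => /=.
  by rewrite !natrD !natrX; ring.
rewrite natrB ?natrD ?natrX; first by ring.
by rewrite (leq_trans (uphalf_leq_pow3 n0)) // leq_addr.
Qed.

(** Multiplying n by r multiplies 3 ^ uphalf n by x ^ ((r - 1) / 2), x = 3 ^ n, so
    this is aurifeuille_expr modulo the divisor. *)
Lemma aurif_dvd b n r : odd n -> coprime r 6 ->
  aurif (b (+) flips r) n %| aurif b (r * n).
Proof.
move=> on r6; set d := aurif _ n; have n0 := odd_gt0 on.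
have or : odd r by move: (coprime6P r6); lia.
have d0 : 0 < d := aurif_gt0 _ n0.
have rn0 : 0 < r * n by rewrite muln_gt0 n0 odd_gt0.
have [d1|] := ltnP 1 d; last by case: d d0 => [|[]] // _ _; rewrite dvd1n.
have : d %| d by []. rewrite {2}/d !dvdn_Zp // !aurif_natr // => /eqP dd; apply/eqP.
set s := ((-1) ^+ (~~ (b (+) flips r)))%R in dd.
have s2 : (s ^+ 2 = 1 :> 'Z_d)%R by rewrite sqrr_sign.
have N2 : ((s * 3%:R ^+ uphalf n) ^+ 2 = 3%:R * 3%:R ^+ n :> 'Z_d)%R.
  by rewrite exprMn s2 mul1r -exprM -exprS; congr (_ ^+ _)%R; lia.
have := aurifeuille_expr r6 N2 dd.
have -> : uphalf (r * n) = uphalf n + n * r./2.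
  have: r * n = 2 * (n * r./2) + n.
    have {1}-> : r = 2 * r./2 + 1 by lia.
    by ring.
  by move: (r * n) (n * r./2) => ? ?; lia.
move=> h; rewrite -[RHS]h exprD (mulnC r) !exprM; congr (_ + _ + _)%R.
rewrite mulrA; congr (_ * _)%R.
rewrite mulrA /s -signr_addb; congr (_ ^+ _ * _)%R.
by case: (b); case: (flips r).
Qed.

Lemma aurif_mul_negb b n : odd n -> aurif b n * aurif (~~ b) n = phi6 (3 ^ n).
Proof. by move=> on; rewrite -aurif_mul //; case: b; rewrite // mulnC. Qed.

(** A common prime of Phi_6 at n and of the factor at r n must divide the factor
    of matching sign at n, as the other one divides the opposite factor at r n,
    which is coprime.  The exponents can then be compared inside Phi_6. *)
Lemma logn_aurif_exp p b n r : prime p -> odd n -> prime r -> 4 < r ->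
  p %| phi6 (3 ^ n) -> p %| aurif b (r * n) ->
  logn p (aurif b (r * n)) <= logn p (aurif (b (+) flips r) n) + logn p r.
Proof.
move=> pp on pr r4 pn prn.
have n0 := odd_gt0 on; have p3 := prime_phi6_pow3 n0 pp pn.
have r6 := prime_coprime6 pr r4.
have or : odd r by move: (coprime6P r6); lia.
have orn : odd (r * n) by rewrite oddM or.
have ndiv : ~~ (p %| aurif (~~ (b (+) flips r)) n).
  have := aurif_coprime p3 pp orn; apply: contra => h.
  have : p %| aurif (~~ b) (r * n).
    by apply: dvdn_trans (aurif_dvd (~~ b) on r6); rewrite -addNb in h.
  by case: (b) prn => -> ->.
apply: leq_trans (_ : logn p (phi6 (3 ^ (r * n))) <= _).
  by apply: dvdn_leq_log; rewrite ?phi6_gt0 // aurif_dvd_phi6.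
rewrite mulnC expnM; apply: leq_trans (logn_phi6_exp p3 pp pr _ pn) _.
  by rewrite expn_gt0.
rewrite leq_add2r -(aurif_mul_negb (b (+) flips r) on) lognM ?aurif_gt0 //.
by rewrite [X in _ + X]logn_coprime ?addn0 // prime_coprime.
Qed.

(** * Removing the primes that already occur at n / r *)

Definition new_prime (L : seq nat) (n : nat) : nat_pred :=
  [pred p | all (fun r => ~~ (p %| phi6 (3 ^ (n %/ r)))) L].

Definition new_part (b : bool) (n : nat) (L : seq nat) : nat :=
  (aurif b n)`_(new_prime L n).

Lemma new_part_gt0 b n L : 0 < new_part b n L.
Proof. exact: part_gt0. Qed.

Lemma logn_partn p (pi : nat_pred) m :
  logn p m`_pi = if p \in pi then logn p m else 0.
Proof.
case: ifP => ppi.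
  rewrite -[LHS]logn_part partn_part ?logn_part // => q.
  by rewrite inE => /eqP ->.
by apply/eqP; rewrite -leqn0 leqNgt logn_gt0 primes_part mem_filter /= ppi.
Qed.

Lemma dvdn_logn m n : 0 < m -> 0 < n ->
  (forall p, prime p -> logn p m <= logn p n) -> m %| n.
Proof.
move=> m0 n0 h; apply/dvdn_partP => // p; rewrite mem_primes => /andP[pp _].
by rewrite p_part pfactor_dvdn // h.
Qed.

Definition distinct_large_primes (L : seq nat) : bool :=
  uniq L && all (fun r => prime r && (4 < r)) L.

(** For primes occurring at n, being new with respect to L means the same at r n
    as at n, because r and the members of L are distinct primes. *)
Lemma new_prime_mul p r n L : prime p -> odd n -> prime r -> 4 < r -> r \notin L ->
  distinct_large_primes L -> {in L, forall s, s %| n} -> p %| phi6 (3 ^ n) ->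
  (p \in new_prime L (r * n)) = (p \in new_prime L n).
Proof.
move=> pp on pr r4 rL /andP[_ /allP bL] Ln pn; apply: eq_in_all => s sL.
have /andP[ps s4] := bL s sL; have /dvdnP[e ne] := Ln s sL.
have [e0 s0] : 0 < e /\ 0 < s.
  by have := odd_gt0 on; rewrite ne muln_gt0 => /andP.
have -> : r * n %/ s = e * r by rewrite ne mulnA mulnK // mulnC.
rewrite ne mulnK // expnM; congr (~~ _).
have [r6 s6] := (prime_coprime6 pr r4, prime_coprime6 ps s4).
have y0 : 0 < 3 ^ e by rewrite expn_gt0.
apply/idP/idP => h.
  apply: (dvdn_phi6_gcd y0 r6 s6 _ h); last by rewrite -expnM -ne.
  by rewrite prime_coprime // dvdn_prime2 //; apply: contraNneq rL => ->.
by rewrite dvdn_phi6_exp // (dvdn_trans h) // phi6_dvd_expr6.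
Qed.

(** Passing from L to r :: L at the number r * n divides the new part by the new
    part at n, and by r at most once.  A prime of the new part for L goes to the
    new part at n if it divides Phi_6 (3 ^ n), and to the one for r :: L if it
    does not, so it is enough to compare the exponents of each prime. *)
Section Step.
Variables (b : bool) (r n : nat) (L : seq nat).
Hypotheses (on : odd n) (pr : prime r) (r4 : 4 < r) (rL : r \notin L).
Hypotheses (bL : distinct_large_primes L) (Ln : {in L, forall s, s %| n}).

Let new_prime_cons p : (p \in new_prime (r :: L) (r * n)) =
  ~~ (p %| phi6 (3 ^ n)) && (p \in new_prime L (r * n)).
Proof. by rewrite !inE /= mulKn // prime_gt0. Qed.

Let logn_old p : prime p -> ~~ (p %| phi6 (3 ^ n)) ->
  logn p (aurif (b (+) flips r) n) = 0.
Proof.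
move=> pp; rewrite -(aurif_mul_negb (b (+) flips r) on) Euclid_dvdM // negb_or.
by case/andP => h _; rewrite logn_coprime // prime_coprime.
Qed.

Lemma new_part_mul_le :
  new_part b (r * n) (r :: L) * new_part (b (+) flips r) n L <= new_part b (r * n) L.
Proof.
apply: dvdn_leq (new_part_gt0 _ _ _) _.
apply: dvdn_logn => [||p pp]; rewrite ?muln_gt0 ?new_part_gt0 //.
rewrite lognM ?new_part_gt0 // !logn_partn new_prime_cons.
have [pn|pn] := boolP (p %| phi6 (3 ^ n)).
  rewrite /= add0n (new_prime_mul pp on) //; case: ifP => // _.
  apply: dvdn_leq_log; first by rewrite aurif_gt0 // muln_gt0 prime_gt0 ?odd_gt0.
  by rewrite aurif_dvd // prime_coprime6.
by rewrite logn_old // if_same addn0.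
Qed.

Lemma new_part_le_mul :
  new_part b (r * n) L <= new_part b (r * n) (r :: L) * new_part (b (+) flips r) n L * r.
Proof.
have r0 := prime_gt0 pr.
apply: dvdn_leq; first by rewrite !muln_gt0 !new_part_gt0.
apply: dvdn_logn => [||p pp]; rewrite ?muln_gt0 ?new_part_gt0 //.
rewrite !lognM ?muln_gt0 ?new_part_gt0 // !logn_partn new_prime_cons.
have [pn|pn] := boolP (p %| phi6 (3 ^ n)); last first.
  by rewrite /= -addnA leq_addr.
rewrite /= add0n (new_prime_mul pp on) //; case: ifP => // _.
have [prn|prn] := boolP (p %| aurif b (r * n)).
  exact: logn_aurif_exp.
by rewrite logn_coprime // prime_coprime.
Qed.
End Step.

(** * Size of the new part *)

Lemma aurif_bounds b n : odd n -> 3 ^ n <= aurif b n * 3 /\ aurif b n <= 3 ^ n * 3.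
Proof.
move=> on; have n0 := odd_gt0 on; have Nx := uphalf_leq_pow3 n0.
have x0 : 0 < 3 ^ n by rewrite expn_gt0.
rewrite /aurif; case: b; first by lia.
(* at n = 1 the smaller factor is 1, the extreme case of the lower bound *)
have [n1|n1] := leqP n 1.
  by have -> : n = 1 by lia.
have : 3 ^ (uphalf n).+1 <= 3 ^ n by rewrite leq_exp2l //; lia.
by rewrite expnS; lia.
Qed.

(** Multiplicative error in the size of the new part: removing r divides two
    quantities each known up to slack L, and r itself may be lost. *)
Definition slack (L : seq nat) : nat := foldr (fun r c => r * c ^ 2) 3 L.

(** For distinct primes, Euler's totient of their product. *)
Definition phi (L : seq nat) : nat := foldr (fun r f => r.-1 * f) 1 L.

(** The number n is written as a multiple m of the product of L, so that
    n * prod (1 - 1/r) is the natural number m * phi L. *)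
Lemma new_part_bounds L : distinct_large_primes L -> forall b m, odd m ->
  let t := new_part b (foldr muln 1 L * m) L in
  3 ^ (m * phi L) <= t * slack L /\ t <= 3 ^ (m * phi L) * slack L.
Proof.
elim: L => [_ b m om|r L IH /andP[/= /andP[rL uL] /andP[/andP[pr r4] aL]] b m om] /=.
  by rewrite mul1n muln1 /new_part partnT ?aurif_gt0 ?odd_gt0 //; apply: aurif_bounds.
have bL : distinct_large_primes L by rewrite /distinct_large_primes uL.
have oL : odd (foldr muln 1 L).
  elim: L aL {IH rL uL bL} => //= s L IH /andP[/andP[ps s4] aL].
  rewrite oddM IH // andbT; move: (coprime6P (prime_coprime6 ps s4)); lia.
have or : odd r by move: (coprime6P (prime_coprime6 pr r4)); lia.
set n := foldr muln 1 L * m; have on : odd n by rewrite oddM oL.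
have Ln : {in L, forall s, s %| n}.
  move=> s; rewrite /n => sL; apply: dvdn_mulr; elim: (L) sL => //= u K IHK.
  by rewrite inE => /orP[/eqP ->|/IHK]; [apply: dvdn_mulr|apply: dvdn_mull].
have := IH bL b (r * m); rewrite oddM or om => /(_ isT) /=.
rewrite mulnCA -/n.
have [] := IH bL (b (+) flips r) m om; rewrite -/n.
have := @new_part_mul_le b r n L on pr r4 rL bL Ln.
have := @new_part_le_mul b r n L on pr r4 rL bL Ln.
rewrite -[r * _ * m]mulnA -/n.
set X := new_part b (r * n) L; set Z := new_part b _ (r :: L).
set Y := new_part _ n L.
have -> : r * m * phi L = m * phi L + m * (r.-1 * phi L).
  by case: (r) r4 => // k _; rewrite succnK; ring.
rewrite expnD; set u := 3 ^ (m * phi L); set v := 3 ^ _; set c := slack L.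
have u0 : 0 < u by rewrite expn_gt0.
have r0 := prime_gt0 pr.
move=> XZY ZYX uY Yu [uvX Xuv]; split; rewrite -(leq_pmul2l u0).
  apply: leq_trans uvX _; apply: leq_trans (_ : (Z * (u * c) * r) * c <= _).
    rewrite leq_mul2r; apply/orP; right; apply: leq_trans XZY _.
    by rewrite leq_mul2r leq_mul2l Yu !orbT.
  by apply/eq_leq; ring.
apply: leq_trans (_ : (Z * Y) * c <= _).
  by rewrite mulnC -mulnA leq_mul2l uY orbT.
apply: leq_trans (_ : u * v * c * c <= _).
  by rewrite leq_mul2r (leq_trans ZYX) ?orbT.
have -> : u * (v * (r * c ^ 2)) = r * (u * v * c * c) by ring.
by rewrite leq_pmull.
Qed.

Lemma phi_gt0 L : distinct_large_primes L -> 0 < phi L.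
Proof.
case/andP=> _; elim: L => //= r L IH /andP[/andP[_ r4] aL].
by rewrite muln_gt0 IH // andbT; lia.
Qed.

(** From slack L <= 3 ^ f with f = phi L, the new slack is at most r * 3 ^ (2 f),
    and r < 3 ^ (r - 3) for r >= 5 leaves room in 3 ^ ((r - 1) f). *)
Lemma slack_cons_lt r L : 4 < r -> 0 < phi L -> slack L <= 3 ^ phi L ->
  slack (r :: L) < 3 ^ phi (r :: L).
Proof.
move=> r4 f0 cf /=.
have rlt : r < 3 ^ (r - 3).
  have -> : r = r - 5 + 5 by lia.
  by elim: (r - 5) => // k IH; rewrite addSn subSn ?expnS; lia.
apply: leq_ltn_trans (_ : r * (3 ^ phi L) ^ 2 < _).
  by rewrite leq_mul2l leq_exp2r // cf orbT.
apply: leq_trans (_ : 3 ^ (r - 3) * (3 ^ phi L) ^ 2 <= _).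
  by rewrite ltn_pmul2r // !expn_gt0.
rewrite -expnM -expnD leq_exp2l //.
have -> : r.-1 * phi L = (r - 3) * phi L + phi L * 2.
  by rewrite (_ : r.-1 = r - 3 + 2); [ring | lia].
by rewrite leq_add2r leq_pmulr.
Qed.

Lemma slack_le L : distinct_large_primes L -> slack L <= 3 ^ phi L.
Proof.
elim: L => // r L IH /andP[/= /andP[_ uL] /andP[/andP[_ r4] aL]].
have bL : distinct_large_primes L by rewrite /distinct_large_primes uL.
by apply/ltnW/slack_cons_lt => //; [apply: phi_gt0 | apply: IH].
Qed.

Lemma prod_primes_dvd n L : uniq L -> all (fun r => prime r && (r %| n)) L ->
  foldr muln 1 L %| n.
Proof.
elim: L => [|r L IH] /=; first by rewrite dvd1n.
case/andP=> rL uL /andP[/andP[pr rn] aL].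
rewrite Gauss_dvd ?rn ?IH //.
elim: L rL aL {IH uL} => [|s L IH] /=; first by rewrite coprimen1.
rewrite inE negb_or => /andP[rs rL] /andP[/andP[ps _] aL].
by rewrite coprimeMr IH // andbT prime_coprime // dvdn_prime2.
Qed.

Definition large_primes (n : nat) : seq nat := [seq r <- primes n | 4 < r].

Lemma large_primes_distinct n : distinct_large_primes (large_primes n).
Proof.
rewrite /distinct_large_primes filter_uniq ?primes_uniq //=; apply/allP => r.
by rewrite mem_filter mem_primes => /andP[-> /andP[->]].
Qed.

(** Let n >= 3.  If n is a power of 3, the lower bound is 3 ^ n / 3 >= 9;
    otherwise the strict inequality slack_cons_lt applies. *)
Lemma new_part_gt1 b n : odd n -> (b || (3 <= n)) -> 1 < new_part b n (large_primes n).
Proof.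
move=> on bn; have n0 := odd_gt0 on.
have bL := large_primes_distinct n.
have [n3|n3] := leqP 3 n; last first.
  have -> : n = 1 by lia.
  by case: b bn => [_|]; [rewrite /new_part partnT // | lia].
have : foldr muln 1 (large_primes n) %| n.
  apply: prod_primes_dvd; first by rewrite filter_uniq ?primes_uniq.
  by apply/allP => r; rewrite mem_filter mem_primes => /andP[_ /and3P[-> _ ->]].
case/dvdnP => m nE; rewrite mulnC in nE.
have om : odd m by move: on; rewrite nE oddM => /andP[].
have [+ _] := new_part_bounds bL b om; rewrite -nE.
set t := new_part _ _ _ => h; rewrite ltnNge; apply/negP => t1.
have : 3 ^ (m * phi (large_primes n)) <= slack (large_primes n).
  by apply: leq_trans h _; rewrite -[leqRHS]mul1n leq_mul2r t1 orbT.
apply/negP; rewrite -ltnNge; case: (large_primes n) nE bL => [|r L] nE bL.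
  rewrite /= muln1; apply: leq_trans (_ : 3 ^ 2 <= _) => //.
  by rewrite leq_exp2l //; move: nE => /=; lia.
apply: leq_trans (_ : 3 ^ phi (r :: L) <= _); last first.
  by rewrite leq_exp2l // leq_pmull ?odd_gt0.
case/andP: bL => /= /andP[_ uL] /andP[/andP[_ r4] aL].
have bL : distinct_large_primes L by rewrite /distinct_large_primes uL.
by apply: slack_cons_lt => //; [apply: phi_gt0 | apply: slack_le].
Qed.

(** * Primitive prime divisors *)

(** If p divided 3^j - 1 with 0 < j < 6n, then the order of 3 modulo p would divide
    6n / r for some prime r.  With x = 3^n we have x^2 - x + 1 = 0 modulo p; r = 2
    would give x^3 = 1 while x^3 = -1, r = 3 would give x^2 = 1, hence x = 2 and
    p = 3, and r >= 5 would make p an old prime. *)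
Lemma ppd_of_new_prime p n : odd n -> prime p -> p %| phi6 (3 ^ n) ->
  p \in new_prime (large_primes n) n -> is_ppd 3 (6 * n) p.
Proof.
move=> on pp pn /allP new; have n0 := odd_gt0 on.
have p3 := prime_phi6_pow3 n0 pp pn; have p1 := prime_gt1 pp.
have xn : ((3%:R ^+ n) ^+ 2 - 3%:R ^+ n + 1 = 0 :> 'Z_p)%R.
  by have /(dvdn_phi6_Zp _ p1) := pn; rewrite natrX.
have x6 : (3%:R ^+ (6 * n) = 1 :> 'Z_p)%R by rewrite mulnC exprM phi6_expr6.
split=> //.
  by apply/dvdn_subn1_Zp; rewrite ?expn_gt0 // natrX.
rewrite Euclid_dvd_prod //; apply/negP; rewrite big_has_cond => /hasP[j].
rewrite mem_index_iota /= => /andP[j1 j6] /dvdn_subn1_Zp.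
rewrite expn_gt0 natrX => /(_ p1 isT) xj.
have n60 : 0 < 6 * n by rewrite muln_gt0.
have xg := expr_gcdn n60 x6 xj; set g := gcdn (6 * n) j in xg.
have g0 : 0 < g by rewrite gcdn_gt0 n60.
have /dvdnP[s sE] : g %| 6 * n := dvdn_gcdl _ _.
have gj : g <= j by apply: dvdn_leq (dvdn_gcdr _ _).
have s1 : 1 < s by rewrite ltnNge; apply/negP => s1; move: sE; nia.
have pr := pdiv_prime s1; have /dvdnP[k kE] := pdiv_dvd s.
set r := pdiv s in pr kE.
have xk : (3%:R ^+ (k * g) = 1 :> 'Z_p)%R by rewrite mulnC exprM xg expr1n.
have rkg : 6 * n = r * (k * g) by rewrite sE kE; ring.
have [r2|r2] := eqVneq r 2.
  have kg : k * g = n * 3 by lia.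
  move: xk; rewrite kg exprM (phi6_cube xn) => /eqP.
  rewrite eq_sym -subr_eq0 opprK (_ : (1 + 1 = 2%:R)%R) //.
  by rewrite -dvdn_Zp // => /dvdn_leq; lia.
have [r3|r3] := eqVneq r 3.
  have kg : k * g = n * 2 by lia.
  move: xk; rewrite kg exprM => x2.
  have x_2 : (3%:R ^+ n = 2%:R :> 'Z_p)%R by rewrite -[LHS]addr0 -xn x2; ring.
  move: x2; rewrite x_2 => /eqP; rewrite -subr_eq0.
  have -> : (2%:R ^+ 2 - 1 = 3%:R :> 'Z_p)%R by ring.
  by rewrite -dvdn_Zp // => /dvdn_leq; lia.
have r4 : 4 < r by move: pr r2 r3; case: (r) => [|[|[|[|[|]]]]].
have r6 := prime_coprime6 pr r4.
have rn : r %| n by rewrite -(Gauss_dvdr _ r6) rkg dvdn_mulr.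
have rL : r \in large_primes n by rewrite mem_filter r4 mem_primes pr n0 rn.
have := new r rL; apply/negP; rewrite negbK.
have kg : k * g = n %/ r * 6.
  apply/eqP; rewrite -(eqn_pmul2l (prime_gt0 pr)) -rkg.
  by rewrite mulnA [r * _]mulnC divnK // mulnC.
apply/(dvdn_phi6_Zp _ p1); rewrite natrX.
apply/(phi6_expr r6); first by rewrite -exprM -kg.
by rewrite -[((3%:R ^+ _) ^+ r)%R]exprM divnK.
Qed.

Lemma aurif_ppd b n : odd n -> b || (3 <= n) ->
  exists p, is_ppd 3 (6 * n) p /\ p %| aurif b n.
Proof.
move=> on bn; have t1 := new_part_gt1 on bn.
have pp := pdiv_prime t1; exists (pdiv (new_part b n (large_primes n))).
have pt : pdiv (new_part b n (large_primes n)) %| aurif b n.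
  exact: dvdn_trans (pdiv_dvd _) (dvdn_part _ _).
split=> //; apply: ppd_of_new_prime => //.
  exact: dvdn_trans pt (aurif_dvd_phi6 b on).
have : pdiv (new_part b n (large_primes n)) \in \pi(new_part b n (large_primes n)).
  by rewrite pi_pdiv.
by rewrite {2}/new_part pi_of_part ?aurif_gt0 ?odd_gt0 // => /andP[].
Qed.

Lemma nat_divides_aurif (R : rcfType) b n p : odd n -> p %| aurif b n ->
  nat_divides_real p
    (if b then t_plus (((3 ^ n)%N)%:R : R)%R else t_minus (((3 ^ n)%N)%:R : R)%R).
Proof.
move=> on pn; exists (Posz (aurif b n)); split; last by [].
rewrite -pmulrn aurif_natr ?odd_gt0 // /t_plus /t_minus.
have -> : (Num.sqrt (3 * (3 ^ n)%:R) = 3 ^+ uphalf n :> R)%R.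
  by rewrite -natrM -sqr_pow3_uphalf // natrX sqrtr_sqr ger0_norm ?natrX ?exprn_ge0.
by rewrite natrX; case: b {pn} => /=; ring.
Qed.

Local Close Scope nat_scope.

Theorem theorem3p7 (R : rcfType) (n q : nat)
  (hn : (1 <= n)%N) (nodd : odd n) (hq : q = (3 ^ n)%N) :
  ((3 <= n)%N ->
     exists p : nat, [/\ is_ppd 3 (6 * n) p, (p %| q ^ 2 - q + 1)%N
                       & nat_divides_real p (t_minus (q%:R : R))])
  /\ (exists p : nat, [/\ is_ppd 3 (6 * n) p, (p %| q ^ 2 - q + 1)%N
                        & nat_divides_real p (t_plus (q%:R : R))]).
Proof.
rewrite hq; split=> [n3|].
  have [p [ppd pn]] := @aurif_ppd false n nodd n3; exists p; split=> //.
    exact: dvdn_trans pn (aurif_dvd_phi6 _ nodd).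
  exact: (@nat_divides_aurif R false).
have [p [ppd pn]] := @aurif_ppd true n nodd isT; exists p; split=> //.
  exact: dvdn_trans pn (aurif_dvd_phi6 _ nodd).
exact: (@nat_divides_aurif R true).
Qed.
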